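(* Let $k$ be a field, $R=k[x_1,\ldots,x_n]$, and let $F=\{x^{v_1},\ldots,x^{v_q}\}\subset R$ be a finite set of distinct monomials of the same degree $d\geq 2$, having no non-trivial common factor and such that every variable $x_i$ divides at least one member of $F$. Let $A=(v_1,\ldots,v_q)$ be the log-matrix of $F$, let $\mathbf{x}_d$ be the set of all monomials of degree $d$ in $R$, and let $e_1,\ldots,e_n$ be the canonical basis of $\mathbb{Z}^n$. The following conditions are equivalent: (a) $k[F]\subset k[\mathbf{x}_d]$ is birational. (b) $\mathbb{Z}^n/\mathbb{Z}(\{v_1-v_j\mid 2\leq j\leq q\})$ is free of rank $1$. (c) $A$ has maximal rank, i.e. $\mathrm{rank}(A)=n$, and $\mathbb{Z}(\{v_1-v_j\mid 2\leq j\leq q\})=\mathbb{Z}(\{e_1-e_k\mid 2\leq k\leq n\})$.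
   Context: For $\alpha=(a_1,\ldots,a_n)\in\mathbb{N}^n$, $x^\alpha=x_1^{a_1}\cdots x_n^{a_n}$. The log-matrix $A$ is the $n\times q$ integer matrix whose columns are the exponent vectors $v_j$. $\mathbb{Z}(V)$ denotes the subgroup of $\mathbb{Z}^n$ generated by a set of vectors $V$. $k[F]$ denotes the $k$-subalgebra of $R$ generated by $F$. An extension $D'\subset D$ of integral domains is birational if $D'$ and $D$ have the same field of fractions. *)

(* Defs.v *)
From HB Require Import structures.
From mathcomp Require Import all_boot all_order all_algebra.
From mathcomp Require Import generic_quotient ring_quotient fraction.
From mathcomp Require Import boolp.
From mathcomp Require Import mpoly.

Set Implicit Arguments.
Unset Strict Implicit.
Unset Printing Implicit Defensive.

Import GRing.Theory.
Local Open Scope ring_scope.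

Definition rdvd (R : comNzRingType) (p f : R) : Prop := exists c : R, f = p * c.

Definition no_common_factor (R : comUnitRingType) (F : {pred R}) : Prop :=
  forall p : R, {in F, forall f, rdvd p f} -> p \is a GRing.unit.

Definition subalg_gen (k : nzRingType) (S : lalgType k) (F : {pred S}) :
    {pred S} :=
  [pred p | `[< forall B : {pred S},
                  subalg_closed B -> {subset F <= B} -> p \in B >]].

(* The fraction field of a subring [D] of the domain [R], realized inside the
   fraction field of [R]. *)
Definition fracs (R : idomainType) (D : {pred R}) : {pred {fraction R}} :=
  [pred z | `[< exists a b : R,
                  [/\ a \in D, b \in D, b != 0 & z = tofrac a / tofrac b] >]].

Definition birational (R : idomainType) (D' D : {pred R}) : Prop :=
  {subset D' <= D} /\ fracs D' =i fracs D.

Definition monomials_of_degree (k : fieldType) (n d : nat) :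
    {pred {mpoly k[n]}} :=
  [pred p | `[< exists2 m : 'X_{1..n}, mdeg m = d & p = 'X_[m] >]].

Definition zspan (M : zmodType) (V : {pred M}) : {pred M} :=
  [pred x | `[< forall H : {pred M},
                  zmod_closed H -> {subset V <= H} -> x \in H >]].

Lemma zspan_zmod_closed (M : zmodType) (V : {pred M}) : zmod_closed (zspan V).
Proof.
split=> [|x y /asboolP Hx /asboolP Hy]; apply/asboolP=> H cH VH.
  by case: cH.
by case: (cH) => _; apply; [apply: Hx | apply: Hy].
Qed.

HB.instance Definition _ (M : zmodType) (V : {pred M}) :=
  GRing.isZmodClosed.Build M (zspan V) (zspan_zmod_closed V).

Definition zquot (M : zmodType) (V : {pred M}) : zmodType :=
  Quotient.quot (zspan V).

Definition free_of_rank (M : zmodType) (r : nat) : Prop :=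
  exists b : 'I_r -> M,
    forall x : M, exists! c : {ffun 'I_r -> int}, x = \sum_(i < r) b i *~ c i.

Definition log_matrix (n q : nat) (v : 'I_q -> 'X_{1..n}) : 'M[int]_(n, q) :=
  \matrix_(i < n, j < q) (v j i)%:Z.

Definition rank_int (m n : nat) (A : 'M[int]_(m, n)) : nat :=
  \rank (map_mx (intr : int -> rat) A).

Definition canon_vec (n : nat) (i : 'I_n) : 'cV[int]_n := delta_mx i 0.

(* [lift ord0] maps ['I_m] onto the nonzero indices of ['I_m.+1], so this is
   the family of the differences [u_1 - u_j] with [j >= 2]. *)
Definition diffs (M : zmodType) (m : nat) (u : 'I_m.+1 -> M) : seq M :=
  [seq u ord0 - u (lift ord0 j) | j : 'I_m].

(* Main.v *)
(* Let L be the lattice spanned by the differences v_1 - v_j and L0 the lattice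
   of vectors with coordinate sum 0, which is spanned by the e_1 - e_k.
   Homogeneity gives L <= L0, and each of the three conditions amounts to
   L = L0.  For birationality, a monomial lies in Frac k[F] iff its exponent
   vector lies in the lattice spanned by the v_j, and a vector of that lattice
   with coordinate sum 0 lies in L because every v_j has the same sum d > 0. *)
Require Import Defs.
From HB Require Import structures.
From mathcomp Require Import all_boot all_order all_algebra.
From mathcomp Require Import generic_quotient ring_quotient fraction.
From mathcomp Require Import boolp.
From mathcomp Require Import mpoly.

Set Implicit Arguments.
Unset Strict Implicit.
Unset Printing Implicit Defensive.

Import GRing.Theory.
Local Open Scope ring_scope.

(** * Subgroups generated by a family and by its differences *)

Lemma sub_zspan (M : zmodType) (V : {pred M}) : {subset V <= zspan V}.
Proof. by move=> x Vx; apply/asboolP => H _; apply. Qed.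

Lemma zspan_min (M : zmodType) (V H : {pred M}) :
  zmod_closed H -> {subset V <= H} -> {subset zspan V <= H}.
Proof. by move=> cH VH x /asboolP; apply. Qed.

Lemma zspan_diffs_sub (M : zmodType) (m : nat) (u : 'I_m.+1 -> M) j :
  u ord0 - u j \in zspan (mem (diffs u)).
Proof.
case: (unliftP ord0 j) => [i|] ->; last by rewrite subrr rpred0.
exact/sub_zspan/image_f.
Qed.

(** Modulo the differences every generator is congruent to [u ord0], so the elements congruent to a
    multiple of [u ord0] form a subgroup containing all the generators. *)
Lemma zspan_codom_diffs (M : zmodType) (m : nat) (u : 'I_m.+1 -> M) x :
  x \in zspan (mem (codom u)) ->
  exists c : int, x - u ord0 *~ c \in zspan (mem (diffs u)).
Proof.
move=> xu; pose H : {pred M} :=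
  [pred y | `[< exists c : int, y - u ord0 *~ c \in zspan (mem (diffs u)) >]].
suff /asboolP : x \in H by [].
apply: (zspan_min _ _ xu) => [|y /codomP [j ->]].
  split=> [|y z /asboolP [b yb] /asboolP [c zc]]; apply/asboolP.
    by exists 0; rewrite subrr rpred0.
  by exists (b - c); rewrite mulrzBr opprD addrACA -opprD rpredB.
apply/asboolP; exists 1.
by rewrite mulr1z -opprB rpredN zspan_diffs_sub.
Qed.

Lemma zspan_diffs_codom (M : zmodType) (m : nat) (u : 'I_m.+1 -> M) :
  {subset zspan (mem (diffs u)) <= zspan (mem (codom u))}.
Proof.
apply: zspan_min => [|_ /imageP [j _ ->]]; first exact: zspan_zmod_closed.
by rewrite rpredB // sub_zspan // codom_f.
Qed.

(** * Coordinate sums and the lattice of vectors of sum zero *)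

Definition coord_sum (n : nat) (x : 'cV[int]_n) : int := \sum_i x i 0.

Lemma coord_sum_is_additive n : zmod_morphism (@coord_sum n).
Proof.
by move=> x y; rewrite /coord_sum -sumrB; apply: eq_bigr => i _; rewrite !mxE.
Qed.

HB.instance Definition _ n :=
  GRing.isZmodMorphism.Build 'cV[int]_n int (@coord_sum n)
    (@coord_sum_is_additive n).

Lemma coord_sum_canon_vec n (i : 'I_n) : coord_sum (canon_vec i) = 1.
Proof.
rewrite /coord_sum (bigD1 i) //= mxE !eqxx big1 ?addr0 // => j /negPf ji.
by rewrite mxE ji.
Qed.

Lemma sum_canon_vec n (x : 'cV[int]_n) : x = \sum_i canon_vec i *~ x i 0.
Proof.
apply/colP => i; rewrite summxE (bigD1 i) //= big1 => [|j /negPf ji].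
  by rewrite -scaler_int !mxE !eqxx /= mulr1 addr0 intz.
by rewrite -scaler_int !mxE eq_sym ji mulr0.
Qed.

Lemma zspan_diffs_coord_sum n m (u : 'I_m.+1 -> 'cV[int]_n) (d : int) :
  (forall j, coord_sum (u j) = d) ->
  {subset zspan (mem (diffs u)) <= [pred x | coord_sum x == 0]}.
Proof.
move=> ud; apply: zspan_min => [|_ /imageP [j _ ->]].
  split=> [|x y]; rewrite !inE ?raddf0 // raddfB /=.
  by move=> /eqP -> /eqP ->.
by rewrite inE raddfB /= !ud subrr.
Qed.

(** If the coordinates of x sum to 0, then subtracting (sum of x_i) e_1 from the expansion of x in
    the canonical basis changes nothing and exhibits x as minus the sum of the x_i (e_1 - e_i). *)
Lemma zspan_diffs_canon_vec n :
  zspan (mem (diffs (@canon_vec n.+1))) =i [pred x | coord_sum x == 0].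
Proof.
move=> x; apply/idP/idP; first exact/zspan_diffs_coord_sum/coord_sum_canon_vec.
move=> /eqP x0; rewrite [x]sum_canon_vec.
suff -> : \sum_i canon_vec i *~ x i 0
        = - \sum_i (canon_vec ord0 - canon_vec i) *~ x i 0.
  by rewrite rpredN rpred_sum // => i _; rewrite rpredMz // zspan_diffs_sub.
under [in RHS]eq_bigr do rewrite mulrzBl.
by rewrite sumrB -mulrz_sumr [\sum_i x i 0]x0 mulr0z sub0r opprK.
Qed.

(** Write x as c u_1 plus an element of the difference lattice. Taking coordinate sums gives c d =
    0, hence c = 0. *)
Lemma zspan_codom_diffs0 n m (u : 'I_m.+1 -> 'cV[int]_n) (d : int) x :
  d != 0 -> (forall j, coord_sum (u j) = d) ->
  x \in zspan (mem (codom u)) -> coord_sum x = 0 ->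
  x \in zspan (mem (diffs u)).
Proof.
move=> d0 ud /zspan_codom_diffs [c xc] x0.
have /eqP := zspan_diffs_coord_sum ud xc.
rewrite raddfB raddfMz /= ud x0 sub0r => /eqP.
rewrite oppr_eq0 -mulrzr mulf_eq0 (negPf d0) /= intz => /eqP c0.
by move: xc; rewrite c0 mulr0z subr0.
Qed.

(** * Generated subalgebras *)

Lemma subalg_gen_closed (k : nzRingType) (S : lalgType k) (F : {pred S}) :
  subalg_closed (subalg_gen F).
Proof.
split=> [|a x y /asboolP xF /asboolP yF|x y /asboolP xF /asboolP yF];
  apply/asboolP => B cB FB; have [B1 BZ BM] := cB => //.
  by apply: BZ; [apply: xF | apply: yF].
by apply: BM; [apply: xF | apply: yF].
Qed.

Lemma sub_subalg_gen (k : nzRingType) (S : lalgType k) (F : {pred S}) :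
  {subset F <= subalg_gen F}.
Proof. by move=> x Fx; apply/asboolP => B _; apply. Qed.

Lemma subalg_gen_min (k : nzRingType) (S : lalgType k) (F B : {pred S}) :
  subalg_closed B -> {subset F <= B} -> {subset subalg_gen F <= B}.
Proof. by move=> cB FB x /asboolP; apply. Qed.

(** * Exponent vectors and supports *)

(** Exponents form only a monoid; as integer columns they can be subtracted, and they match the
    columns of [log_matrix]. *)
Definition mvec (n : nat) (m : 'X_{1..n}) : 'cV[int]_n := \col_i (m i)%:Z.

Lemma mvecD n (a b : 'X_{1..n}) : mvec (a + b)%MM = mvec a + mvec b.
Proof. by apply/colP => i; rewrite !mxE mnmDE PoszD. Qed.

Lemma mvec0 n : mvec (0%MM : 'X_{1..n}) = 0.
Proof. by apply/colP => i; rewrite !mxE mnm0E. Qed.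

Lemma mvec_inj n : injective (@mvec n).
Proof.
by move=> a b /colP ab; apply/mnmP => i; have := ab i; rewrite !mxE => -[].
Qed.

Lemma mvecU n (i : 'I_n) : mvec U_(i)%MM = canon_vec i.
Proof. by apply/colP => j; rewrite !mxE mnm1E eqxx andbT eq_sym; case: eqP. Qed.

Lemma coord_sum_mvec n (m : 'X_{1..n}) : coord_sum (mvec m) = (mdeg m)%:Z.
Proof.
rewrite mdegE /coord_sum (big_morph Posz PoszD (erefl _)).
by apply: eq_bigr => i _; rewrite mxE.
Qed.

(** The polynomials supported on a given subgroup form a subalgebra, because exponents add under
    multiplication; this one contains the generators. *)
Lemma msupp_subalg_gen (k : fieldType) n m (v : 'I_m -> 'X_{1..n})
    (p : {mpoly k[n]}) a :
  p \in subalg_gen (mem [seq 'X_[v j] | j : 'I_m]) -> a \in msupp p ->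
  mvec a \in zspan (mem (codom (fun j => mvec (v j)))).
Proof.
set V := zspan _ => pF; move: a; apply/allP.
pose B : {pred {mpoly k[n]}} := [pred p | all (fun a => mvec a \in V) (msupp p)].
have memB (f : {mpoly k[n]}) :
  (f \in B) = all (fun a => mvec a \in V) (msupp f) by [].
apply: (subalg_gen_min (B := B)) pF; last first.
  move=> _ /imageP [j _ ->]; rewrite memB msuppX /= andbT.
  exact/sub_zspan/codom_f.
split=> [|c f g /allP fB /allP gB|f g /allP fB /allP gB].
- by rewrite memB msupp1 /= mvec0 rpred0.
- apply/allP => a /msuppD_le; rewrite mem_cat => /orP [/msuppZ_le|]; auto.
- apply/allP => _ /msuppM_le /allpairsP [[a b] [/fB af /gB bg ->]].
  by rewrite mvecD rpredD.
Qed.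

(** * Fractions over a subalgebra of the polynomial ring *)

Lemma mem_fracs (R : idomainType) (D : {pred R}) a b :
  a \in D -> b \in D -> b != 0 -> tofrac a / tofrac b \in fracs D.
Proof. by move=> aD bD b0; apply/asboolP; exists a, b. Qed.

Lemma tofrac_mem_fracs (R : idomainType) (D : {pred R}) a :
  1 \in D -> a \in D -> tofrac a \in fracs D.
Proof.
move=> D1 aD; rewrite -[tofrac a]divr1 -(tofrac1 R).
by apply: mem_fracs => //; apply: oner_neq0.
Qed.

(** Sums and products of fractions are computed over the product of the denominators. This reduces
    an inclusion of a generated subalgebra into a fraction field to its generators. *)
Lemma subalg_closed_fracs (k : fieldType) n (D : {pred {mpoly k[n]}}) :
  subalg_closed D -> subalg_closed [pred p | tofrac p \in fracs D].
Proof.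
move=> [D1 DZ DM]; have DC c : c%:MP \in D.
  (* Linear closure gives 0 as (-1) 1 + 1, and then the constant c as c 1 + 0. *)
  have D0 : 0 \in D by have := DZ (-1) _ _ D1 D1; rewrite scaleN1r addNr.
  by have := DZ c _ _ D1 D0; rewrite addr0 -mul_mpolyC mulr1.
split=> [|c f g|f g].
- exact: tofrac_mem_fracs.
- move=> /asboolP [a1 [b1 [a1D b1D b10 fE]]].
  move=> /asboolP [a2 [b2 [a2D b2D b20 gE]]].
  rewrite inE tofracD -mul_mpolyC tofracM fE gE mulrA addf_div ?tofrac_eq0 //.
  rewrite -!tofracM -tofracD; apply: mem_fracs; rewrite ?mulf_neq0 ?DM //.
  by rewrite -mulrA mul_mpolyC DZ ?DM.
- move=> /asboolP [a1 [b1 [a1D b1D b10 fE]]].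
  move=> /asboolP [a2 [b2 [a2D b2D b20 gE]]].
  rewrite inE tofracM fE gE mulf_div -!tofracM.
  by apply: mem_fracs; rewrite ?mulf_neq0 ?DM.
Qed.

Lemma fracs_mono (R : idomainType) (D D' : {pred R}) :
  {subset D <= D'} -> {subset fracs D <= fracs D'}.
Proof.
by move=> DD' _ /asboolP [a [b [aD bD b0 ->]]]; apply: mem_fracs => //; apply: DD'.
Qed.

(** Differences of exponents of monomials in [D] form a subgroup containing every v_j, so each
    lattice vector is such a difference and its monomial is a quotient of two monomials of [D]. *)
Lemma mpolyX_fracs (k : fieldType) n m (v : 'I_m -> 'X_{1..n}) (a : 'X_{1..n}) :
  let D := subalg_gen (mem [seq ('X_[v j] : {mpoly k[n]}) | j : 'I_m]) in
  mvec a \in zspan (mem (codom (fun j => mvec (v j)))) ->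
  tofrac 'X_[a] \in fracs D.
Proof.
move=> D aV; have [D1 _ DM] : subalg_closed D by apply: subalg_gen_closed.
pose H : {pred 'cV[int]_n} := [pred x | `[< exists b c : 'X_{1..n},
  [/\ 'X_[b] \in D, 'X_[c] \in D & x = mvec b - mvec c] >]].
have /asboolP : mvec a \in H.
  apply: (zspan_min _ _ aV) => [|_ /codomP [j ->]].
    split=> [|x y /asboolP [b [c [bD cD ->]]] /asboolP [b' [c' [bD' cD' ->]]]];
      apply/asboolP.
      by exists 0%MM, 0%MM; rewrite mpolyX0 D1 subrr.
    exists (b + c')%MM, (c + b')%MM; rewrite !mpolyXD !DM //; split=> //.
    by rewrite !mvecD opprB addrACA -opprD.
  apply/asboolP; exists (v j), 0%MM; rewrite mpolyX0 D1 mvec0 subr0; split=> //.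
  exact/sub_subalg_gen/image_f.
move=> [b [c [bD cD acb]]].
have c0 : 'X_[c] != 0 :> {mpoly k[n]} by rewrite -msupp_eq0 msuppX.
have XE : tofrac 'X_[a] = tofrac 'X_[b] / tofrac 'X_[c]
          :> {fraction {mpoly k[n]}}.
  (* Moving c to the other side turns the integer identity a = b - c into one between natural
     exponents. *)
  have -> : b = (a + c)%MM by apply: mvec_inj; rewrite mvecD acb subrK.
  by rewrite mpolyXD tofracM mulfK // tofrac_eq0.
by rewrite XE mem_fracs.
Qed.

(* A monomial that is a quotient f/g maps supp(g) into supp(f). *)
Lemma mpolyX_fracs_zspan (k : fieldType) n m (v : 'I_m -> 'X_{1..n})
    (a : 'X_{1..n}) :
  let D := subalg_gen (mem [seq ('X_[v j] : {mpoly k[n]}) | j : 'I_m]) in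
  tofrac 'X_[a] \in fracs D ->
  mvec a \in zspan (mem (codom (fun j => mvec (v j)))).
Proof.
move=> D /asboolP [f [g [fD gD g0 aE]]].
have {}aE : g * 'X_[a] = f.
  apply/eqP; rewrite -tofrac_eq tofracM aE mulrCA divff ?mulr1 //.
  by rewrite tofrac_eq0.
pose b := mlead g; have bg : b \in msupp g by apply: mlead_supp.
have abf : (a + b)%MM \in msupp f.
  by rewrite mcoeff_msupp -aE mcoeffMX -mcoeff_msupp.
rewrite -[mvec a](addrK (mvec b)) -mvecD.
by rewrite rpredB // (msupp_subalg_gen _ abf, msupp_subalg_gen _ bg).
Qed.

(** * Each condition compared with the equality of lattices L = L0 *)

Section UniformDegree.

Variables (n q d : nat) (v : 'I_q.+1 -> 'X_{1..n.+1}).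
Hypotheses (d_gt0 : (0 < d)%N) (v_deg : forall j, mdeg (v j) = d).

Let u j := mvec (v j).
Let L := zspan (mem (diffs u)).
Let L0 := zspan (mem (diffs (@canon_vec n.+1))).

Let u_sum j : coord_sum (u j) = d%:Z.
Proof. by rewrite coord_sum_mvec v_deg. Qed.

Lemma zspan_diffs_mvec_sub : {subset L <= L0}.
Proof.
by move=> x /(zspan_diffs_coord_sum u_sum); rewrite zspan_diffs_canon_vec.
Qed.

Lemma birational_zspan (k : fieldType) :
  birational (subalg_gen (mem [seq ('X_[v j] : {mpoly k[n.+1]}) | j : 'I_q.+1]))
             (subalg_gen (@monomials_of_degree k n.+1 d)) ->
  L =i L0.
Proof.
move=> [_ fracE] x; apply/idP/idP; first exact: zspan_diffs_mvec_sub.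
apply: zspan_min x => [|_ /imageP [j _ ->]]; first exact: zspan_zmod_closed.
have memV a : mdeg a = d -> mvec a \in zspan (mem (codom u)).
  move=> ad; apply: (@mpolyX_fracs_zspan k); rewrite fracE.
  have [E1 _ _] := subalg_gen_closed (@monomials_of_degree k n.+1 d).
  apply: tofrac_mem_fracs => //.
  by apply: sub_subalg_gen; apply/asboolP; exists a.
apply: (zspan_codom_diffs0 _ u_sum); last first.
- by rewrite raddfB /= !coord_sum_canon_vec subrr.
(* The degree-d monomials x_1^(d-1) x_1 and x_1^(d-1) x_k have exponent difference e_1 - e_k; d > 0
   makes the exponent [d.-1] genuine. *)
- have memU i : mvec (U_(ord0) *+ d.-1 + U_(i))%MM \in zspan (mem (codom u)).
    by apply: memV; rewrite mdegD mdegMn !mdeg1 mul1n addn1 prednK.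
  have := rpredB (memU ord0) (memU (lift ord0 j)).
  by rewrite !mvecD !mvecU opprD addrACA subrr add0r.
- by have := d_gt0; rewrite lt0n.
Qed.

Lemma zspan_birational (k : fieldType) :
  L =i L0 ->
  birational (subalg_gen (mem [seq ('X_[v j] : {mpoly k[n.+1]}) | j : 'I_q.+1]))
             (subalg_gen (@monomials_of_degree k n.+1 d)).
Proof.
move=> LE; set D := subalg_gen _; set E := subalg_gen _.
have DE : {subset D <= E}.
  apply: subalg_gen_min; first exact: subalg_gen_closed.
  move=> _ /imageP [j _ ->]; apply: sub_subalg_gen.
  by apply/asboolP; exists (v j).
split=> // z; apply/idP/idP; first exact: fracs_mono.
have EF : {subset E <= [pred p | tofrac p \in fracs D]}.
  apply: subalg_gen_min => [|_ /asboolP [a ad ->]].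
    exact/subalg_closed_fracs/subalg_gen_closed.
  apply: mpolyX_fracs.
  (* For a of degree d, a - v_1 has coordinate sum 0, so it lies in L0 = L, and adding v_1 back
     stays in the lattice of the v_j. *)
  rewrite -[mvec a](subrK (u ord0)) rpredD //; last exact/sub_zspan/codom_f.
  apply: zspan_diffs_codom; rewrite -/L LE zspan_diffs_canon_vec inE.
  by rewrite raddfB /= u_sum coord_sum_mvec ad subrr.
move=> /asboolP [a [b [/EF /asboolP [a1 [a2 [a1D a2D a20 aE]]]]]].
move=> /EF /asboolP [b1 [b2 [b1D b2D b20 bE]]] b0 ->.
have DM := let: And3 _ _ DM := subalg_gen_closed _ in DM.
(* The denominator [b] is itself a fraction b1 / b2 over [D]; inverting it puts b1 in the new
   denominator. *)
have b10 : b1 != 0.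
  by apply: contraNneq b0 => b10; rewrite -tofrac_eq0 bE b10 tofrac0 mul0r.
rewrite aE bE invf_div mulf_div -!tofracM.
by apply: mem_fracs; rewrite ?mulf_neq0 ?DM.
Qed.

(** Since L0 is the kernel of the surjective coordinate sum, the quotient is Z, with the class of
    e_1 as basis and the coordinate sum as coefficient. *)
Lemma zspan_free_rank1 : L =i L0 -> free_of_rank (zquot (mem (diffs u))) 1.
Proof.
move=> LE; pose pi : 'cV[int]_n.+1 -> zquot (mem (diffs u)) := \pi%qT.
have pi_eq x y : (pi x == pi y) = (coord_sum x == coord_sum y).
  rewrite /pi -Quotient.idealrBE -/L LE zspan_diffs_canon_vec inE.
  by rewrite raddfB /= subr_eq0.
have piMz x c : pi x *~ c = pi (x *~ c) by rewrite /pi raddfMz.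
exists (fun=> pi (canon_vec ord0)) => x.
rewrite -[x]reprK -/(pi _); set y := repr x.
exists [ffun=> coord_sum y]; split=> [|c].
  rewrite big_ord1 ffunE piMz; apply/eqP; rewrite pi_eq raddfMz /=.
  by rewrite coord_sum_canon_vec intz.
rewrite big_ord1 piMz => /eqP; rewrite pi_eq raddfMz /= coord_sum_canon_vec intz.
by move=> /eqP yc; apply/ffunP => i; rewrite ffunE ord1 yc.
Qed.

(* Z^n/L surjects onto Z^n/L0 = Z through the coordinate sum, so a single
   generator of Z^n/L has nonzero sum, which leaves no room for a kernel. *)
Lemma free_rank1_zspan : free_of_rank (zquot (mem (diffs u))) 1 -> L =i L0.
Proof.
move=> [b b_basis]; pose pi : 'cV[int]_n.+1 -> zquot (mem (diffs u)) := \pi%qT.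
pose y := repr (b ord0).
have gen x : exists c : int, x - y *~ c \in L.
  have [c [xE _]] := b_basis (pi x); exists (c ord0).
  rewrite Quotient.idealrBE raddfMz /= -/(pi x) xE big_ord1.
  by rewrite reprK.
move=> x; apply/idP/idP; first exact: zspan_diffs_mvec_sub.
rewrite zspan_diffs_canon_vec inE => /eqP x0.
have sum_gen z c : z - y *~ c \in L -> coord_sum z = coord_sum y * c.
  move=> /(zspan_diffs_coord_sum u_sum).
  by rewrite inE raddfB raddfMz /= subr_eq0 mulrzz => /eqP.
(* As e_1 has sum 1, the sum of [y] divides 1 and cannot vanish; hence the coefficient of [x], whose
   sum is 0, must be 0. *)
have [c0 /sum_gen yc0] := gen (canon_vec ord0).
have [c xc] := gen x; have := sum_gen _ _ xc; rewrite x0 => /esym/eqP.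
rewrite mulf_eq0 => /orP [/eqP y0|/eqP c_eq0].
  by move: yc0; rewrite y0 mul0r coord_sum_canon_vec.
by move: xc; rewrite c_eq0 mulr0z subr0.
Qed.

(** A rational row [w] killing all columns v_j kills L = L0, hence every e_1 - e_i, so its entries
    are all equal. Pairing it with v_1 gives d times the common entry, and d > 0 forces [w] to
    vanish. *)
Lemma zspan_rank : L =i L0 -> rank_int (log_matrix v) = n.+1.
Proof.
move=> LE; apply/eqP; rewrite /rank_int -/(row_free _).
rewrite -kermx_eq0 -submx0; apply/rV_subP => w /sub_kermxP wA.
pose H : {pred 'cV[int]_n.+1} :=
  [pred x | w *m map_mx (intr : int -> rat) x == 0].
have cH : zmod_closed H.
  split=> [|x y]; rewrite !inE ?map_mx0 ?mulmx0 // => /eqP x0 /eqP y0.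
  by rewrite map_mxB mulmxBr x0 y0 subrr.
have uH j : u j \in H.
  have -> : u j = col j (log_matrix v) by apply/colP => i; rewrite !mxE.
  by rewrite inE map_col colE mulmxA wA mul0mx.
have LH : {subset L <= H}.
  by apply: zspan_min => // _ /imageP [j _ ->]; have [_] := cH; apply.
have wi i : w 0 i = w 0 ord0.
  have : canon_vec ord0 - canon_vec i \in H by rewrite LH // LE zspan_diffs_sub.
  rewrite inE map_mxB mulmxBr /canon_vec !map_delta_mx -!colE subr_eq0.
  by move=> /eqP/colP /(_ 0); rewrite !mxE.
have := uH ord0; rewrite inE => /eqP/colP /(_ 0); rewrite !mxE.
under eq_bigr => i _ do rewrite wi !mxE.
rewrite -mulr_sumr -rmorph_sum /= => /eqP; rewrite mulf_eq0 => /orP [/eqP w0|].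
  by rewrite (_ : w = 0) ?sub0mx //; apply/rowP => i; rewrite wi w0 mxE.
have -> : \sum_i (v ord0 i)%:Z = d%:Z.
  by rewrite -(u_sum ord0); apply: eq_bigr => i _; rewrite mxE.
by rewrite intr_eq0 => /eqP [d0]; move: d_gt0; rewrite d0.
Qed.

End UniformDegree.

Theorem theorem2p6 (k : fieldType) (n q d : nat)
    (v : 'I_q.+1 -> 'X_{1..n.+1})
    (F := [seq 'X_[v j] | j : 'I_q.+1] : seq {mpoly k[n.+1]})
    (A := log_matrix v)
    (hd : (2 <= d)%N)
    (v_inj : injective v)
    (v_deg : forall j, mdeg (v j) = d)
    (F_ncf : no_common_factor (mem F))
    (F_vars : forall i : 'I_n.+1, exists2 f, f \in F & rdvd 'X_i f) :
  [<-> birational (subalg_gen (mem F))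
                  (subalg_gen (@monomials_of_degree k n.+1 d));
       free_of_rank (zquot (mem (diffs (fun j => col j A)))) 1;
       rank_int A = n.+1 /\
       zspan (mem (diffs (fun j => col j A)))
         =i zspan (mem (diffs (@canon_vec n.+1)))].
Proof.
have d_gt0 : (0 < d)%N by apply: ltnW.
(* The columns of the log-matrix are the exponent vectors, which brings the statement to the form
   used for L. *)
have -> : (fun j => col j A) = (fun j => mvec (v j)).
  by apply/funext => j; apply/colP => i; rewrite !mxE.
tfae=> [bir|free|[_ LE]].
- exact: zspan_free_rank1 (birational_zspan d_gt0 v_deg bir).
- have LE := free_rank1_zspan v_deg free.
  by split=> //; exact: zspan_rank d_gt0 v_deg LE.
- exact: (zspan_birational v_deg) LE.
Qed.
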